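(* Up to isomorphism there exist exactly $12$ commutative nilpotent associative algebras of dimension $4$ over $\mathbb{R}$: every such algebra is isomorphic to one of the following pairwise non-isomorphic commutative nilpotent associative algebras, each with basis $a,b,c,d$ and the indicated nonzero products (where a superscript $\alpha=\pm1$ indicates two algebras, one for $\alpha=1$ and one for $\alpha=-1$). With central component: - $J_{4,1}$: all products are zero; - $J_{4,2}$: $a^2=b$; - $J_{4,3}^{\alpha=\pm1}$: $a^2=c,\ b^2=\alpha c$; - $J_{4,4}$: $a^2=b,\ a\circ b=c$. Without central component: - $J_{4,5}^{\alpha=\pm1}$: $a^2=d,\ b^2=d,\ c^2=\alpha d$; - $J_{4,7}$: $a^2=b,\ a\circ b=d,\ c^2=d$; - $J_{4,11}$: $a^2=b,\ a\circ b=c,\ a\circ c=d,\ b^2=d$; - $J_{4,12}$: $a^2=c,\ a\circ b=d$; - $J_{4,13}^{\alpha=\pm1}$: $a^2=c,\ b^2=\alpha c,\ a\circ b=d$.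
   Context: The product of an algebra $J$ is denoted $\circ$, and $x^2=x\circ x$. Algebras are not required to have a unit. Set $c^1(J)=J$ and $c^m(J)=c^{m-1}(J)\circ J$ (the span of the products) for $m\geq 2$; $J$ is nilpotent if $c^n(J)=0$ for some $n$. The centre of a commutative algebra $J$ is here $Z(J)=\{x\in J: x\circ y=0\ \forall y\in J\}$. $J$ has a central component if $J=I_1\oplus I_2$ is a direct sum of two ideals with $I_2$ nonzero and contained in $Z(J)$. In the multiplication tables, all products of basis vectors that are not listed (and do not follow from commutativity) are zero. *)

(* Defs.v *)
From HB Require Import structures.
From mathcomp Require Import all_boot all_order all_algebra reals.

Set Implicit Arguments.
Unset Strict Implicit.
Unset Printing Implicit Defensive.

Import GRing.Theory.
Local Open Scope ring_scope.

(* A finite-dimensional algebra: neither associative nor unital a priori. *)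
Record algebra (F : fieldType) := NAAlgebra {
  carrier :> vectType F;
  prodA : {bilinear carrier -> carrier -> carrier}
}.

Notation "x ∘ y" := (prodA _ x y) (at level 40, left associativity) : ring_scope.

Definition isomorphic (F : fieldType) (J K : algebra F) : Prop :=
  exists2 f : {linear J -> K},
    bijective f & {morph f : x y / x ∘ y >-> x ∘ y}.

(* By bilinearity, the span of the products of elements of U and V is already
   spanned by the products of basis vectors; see mulvsP. *)
Definition mulvs (F : fieldType) (J : algebra F) (U V : {vspace J}) :
    {vspace J} :=
  <<[seq u ∘ v | u <- vbasis U, v <- vbasis V]>>%VS.

(* c^m(J) for m >= 1; the value at m = 0, not used in the literature, is J. *)
Definition lower_power (F : fieldType) (J : algebra F) (m : nat) : {vspace J} :=
  iter m.-1 (fun U => mulvs U fullv) fullv.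

Definition nilpotent_algebra (F : fieldType) (J : algebra F) : Prop :=
  exists2 n : nat, (0 < n)%N & lower_power J n = 0%VS.

(* This is the annihilator, not the set of elements commuting with everything;
   it is meant for commutative J. *)
Definition in_centre (F : fieldType) (J : algebra F) (x : J) : Prop :=
  forall y : J, x ∘ y = 0.

Definition is_ideal (F : fieldType) (J : algebra F) (I : {vspace J}) : Prop :=
  forall x y : J, x \in I -> x ∘ y \in I /\ y ∘ x \in I.

Definition has_central_component (F : fieldType) (J : algebra F) : Prop :=
  exists I1 I2 : {vspace J},
    [/\ is_ideal I1, is_ideal I2, (I1 + I2 = fullv)%VS & directv (I1 + I2)]
    /\ I2 != 0%VS /\ (forall x : J, x \in I2 -> in_centre x).

Definition is_comm_nilp_assoc (F : fieldType) (J : algebra F) : Prop :=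
  [/\ commutative (@prodA F J : J -> J -> J),
      associative (@prodA F J : J -> J -> J) & nilpotent_algebra J].

Lemma mulvsP (F : fieldType) (J : algebra F) (U V W : {vspace J}) :
  (forall u v, u \in U -> v \in V -> u ∘ v \in W) <-> (mulvs U V <= W)%VS.
Proof.
split=> [sUVW | sUVW u v /coord_vbasis-> /coord_vbasis->].
  apply/span_subvP=> _ /allpairsP[[u v] /= [Uu Vv ->]].
  by rewrite sUVW ?vbasis_mem.
rewrite (subvP sUVW) // linear_sumlz memv_suml // => i _.
rewrite linear_sumr memv_suml // => j _.
rewrite linearZl_LR linearZr_LR !memvZ // memv_span //.
by apply/allpairsP; exists ((vbasis U)`_i, (vbasis V)`_j); rewrite !memt_nth.
Qed.

(* A multiplication table lists triples (i, j, v), meaning e_i ∘ e_j = v and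
   e_j ∘ e_i = v.  Unlisted products are zero (empty sums); a table must not
   list the same unordered pair {i, j} twice. *)
Definition table (F : fieldType) := seq ('I_4 * 'I_4 * 'rV[F]_4).

Definition basis_prod (F : fieldType) (t : table F) (i j : 'I_4) : 'rV[F]_4 :=
  \sum_(p <- t | (p.1 == (i, j)) || (p.1 == (j, i))) p.2.

Definition table_prod (F : fieldType) (t : table F) (x y : 'rV[F]_4) :
    'rV[F]_4 :=
  \sum_(i < 4) \sum_(j < 4) (x 0 i * y 0 j) *: basis_prod t i j.

Fact table_prod_bilinear (F : fieldType) (t : table F) :
  bilinear_for *:%R *:%R (table_prod t).
Proof.
split=> z a x y; rewrite /= /table_prod scaler_sumr -big_split /=;
  apply: eq_bigr => i _; rewrite scaler_sumr -big_split /=;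
  apply: eq_bigr => j _; rewrite !mxE scalerA -scalerDl.
  by rewrite mulrDl mulrA.
by rewrite mulrDr mulrCA.
Qed.

HB.instance Definition _ (F : fieldType) (t : table F) :=
  bilinear_isBilinear.Build F 'rV[F]_4 'rV[F]_4 'rV[F]_4 *:%R *:%R
    (table_prod t) (table_prod_bilinear t).

Definition algebra_of_table (F : fieldType) (t : table F) : algebra F :=
  @NAAlgebra F 'rV[F]_4 (table_prod t).

Lemma table_prod_basis (F : fieldType) (t : table F) (i j : 'I_4) :
  table_prod t (delta_mx 0 i) (delta_mx 0 j) = basis_prod t i j.
Proof.
rewrite /table_prod (bigD1 i) //= [X in _ + X]big1 ?addr0 => [|k /negPf nki].
  rewrite (bigD1 j) //= big1 ?addr0 => [|k /negPf nkj]; rewrite !mxE !eqxx /=.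
    by rewrite mulr1 scale1r.
  by rewrite nkj mulr0 scale0r.
by rewrite big1 // => l _; rewrite !mxE nki mul0r scale0r.
Qed.

Section Tables.

Variable F : fieldType.

Local Notation a := (@Ordinal 4 0 isT).
Local Notation b := (@Ordinal 4 1 isT).
Local Notation c := (@Ordinal 4 2 isT).
Local Notation d := (@Ordinal 4 3 isT).
Local Notation e i := (delta_mx 0 i : 'rV[F]_4).

Definition T4_1 : table F := [::].

Definition T4_2 : table F := [:: (a, a, e b)].

Definition T4_3 (alpha : F) : table F :=
  [:: (a, a, e c); (b, b, alpha *: e c)].

Definition T4_4 : table F :=
  [:: (a, a, e b); (a, b, e c)].

Definition T4_5 (alpha : F) : table F :=
  [:: (a, a, e d); (b, b, e d); (c, c, alpha *: e d)].

Definition T4_7 : table F :=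
  [:: (a, a, e b); (a, b, e d); (c, c, e d)].

Definition T4_11 : table F :=
  [:: (a, a, e b); (a, b, e c); (a, c, e d); (b, b, e d)].

Definition T4_12 : table F :=
  [:: (a, a, e c); (a, b, e d)].

Definition T4_13 (alpha : F) : table F :=
  [:: (a, a, e c); (b, b, alpha *: e c); (a, b, e d)].

Definition with_central : 5.-tuple (table F) :=
  [tuple T4_1; T4_2; T4_3 1; T4_3 (-1); T4_4].

Definition without_central : 7.-tuple (table F) :=
  [tuple T4_5 1; T4_5 (-1); T4_7; T4_11; T4_12; T4_13 1; T4_13 (-1)].

Definition J_with_central (i : 'I_5) : algebra F :=
  algebra_of_table (tnth with_central i).

Definition J_without_central (i : 'I_7) : algebra F :=
  algebra_of_table (tnth without_central i).

Definition J_listed (i : 'I_12) : algebra F :=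
  algebra_of_table (tnth [tuple of with_central ++ without_central] i).

End Tables.

(* Main.v *)
Require Import Defs.
From HB Require Import structures.
From mathcomp Require Import all_boot all_order all_algebra reals.
From mathcomp Require Import boolp ring lra.

(** By polarization a nonzero double (triple) product forces a nonzero square
    (cube). If [a ∘ a ∘ a != 0] for some [a], then nilpotency makes the powers of [a]
    independent: either they form a basis, or [a^4 = 0] and a complementary
    generator [y] can be chosen with [a ∘ y = 0] and [y ∘ y] a multiple of
    [a ∘ a ∘ a]. If all triple products vanish, the product is a symmetric
    bilinear map with central values. When its values lie on a line it is a real
    quadratic form and Sylvester's diagonalisation applies; otherwise there are
    [a], [b] such that [a], [b], [a ∘ a], [b ∘ b] is a basis, and completing the
    square in the only relation between [a ∘ a], [a ∘ b], [b ∘ b] yields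
    generators with [a ∘ a = k *: (b ∘ b)], so the sign of [k] decides.
    The twelve algebras are told apart by properties stated with products only
    (vanishing squares or products of noncentral elements, central elements
    outside the square, and so on). *)

Set Implicit Arguments.
Unset Strict Implicit.
Unset Printing Implicit Defensive.

Import Order.TTheory GRing.Theory Num.Theory.
Local Open Scope ring_scope.

(** * Central components, bases, and isomorphisms onto tables *)

Section Isomorphism.

Variable F : fieldType.
Implicit Types J K : algebra F.

Lemma isomorphic_sym J K : isomorphic J K -> isomorphic K J.
Proof.
move=> [f [g fK gK] fM].
pose g' : {linear K -> J} :=
  HB.pack g (GRing.isLinear.Build F K J *:%R g (can2_linear fK gK)).
exists g'; first by exists f.
by move=> x y; apply: (can_inj fK); rewrite /= fM !gK.
Qed.

(** As [W] may be any subspace containing the square of [J], this says that the annihilator is not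
    contained in the square. For commutative [J] it is equivalent to having a central component, and
    it is easier to test and to transport. *)
Definition centre_outside_square J : Prop :=
  exists (z : J) (W : {vspace J}),
    [/\ in_centre z, forall x y : J, x ∘ y \in W & z \notin W].

(** Since [I2] annihilates everything, all products lie in [I1], which meets [I2] only in 0. *)
Lemma central_component_outside_square J :
  has_central_component J -> centre_outside_square J.
Proof.
move=> [I1 [I2 [[idI1 idI2 I12 /directv_addP capI] [I2n0 I2c]]]].
exists (vpick I2), I1; split.
- exact/I2c/memv_pick.
- move=> x y; have: x \in (I1 + I2)%VS by rewrite I12 memvf.
  move=> /memv_addP[u uI1 [v /I2c vc ->]].
  by rewrite linearDl vc addr0; have [] := idI1 u y uI1.
- apply/negP => zI1; have: vpick I2 \in (I1 :&: I2)%VS.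
    by rewrite memv_cap zI1 memv_pick.
  by rewrite capI memv0 vpick0 (negPf I2n0).
Qed.

(** Every subspace containing all products is an ideal, so [W] can be enlarged to a complement of
    the line of [z]. *)
Lemma central_component_of_outside_square J :
  commutative (@prodA F J : J -> J -> J) ->
  centre_outside_square J -> has_central_component J.
Proof.
move=> mulC [z [W [zc JW zW]]]; pose C := ((W + <[z]>)^C)%VS.
have z0 : z != 0 by apply: contraNneq zW => ->; apply: mem0v.
have zWC : z \notin (W + C)%VS.
  apply: contra zW => /memv_addP[w wW [c cC zE]].
  have : c \in ((W + <[z]>) :&: C)%VS.
    rewrite memv_cap cC andbT (_ : c = - w + z).
      by rewrite memv_add ?memv_line // memvN.
    by rewrite zE addKr.
  by rewrite capv_compl memv0 => /eqP c0; rewrite zE c0 addr0.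
exists (W + C)%VS, <[z]>%VS; split; last split.
- split.
  + by move=> x y _; rewrite !(subvP (addvSl W C)) ?JW.
  + move=> x y /vlineP[k ->].
    by rewrite linearZl_LR linearZr_LR [y ∘ z]mulC zc scaler0 mem0v.
  + by rewrite -addvA [(C + _)%VS]addvC addvA addv_complf.
  + apply/directv_addP/eqP; rewrite -subv0; apply/subvP => x.
    rewrite memv_cap memv0 => /andP[xWC /vlineP[k xE]]; rewrite xE.
    have [->|k0] := eqVneq k 0; first by rewrite scale0r.
    case/negP: zWC; rewrite -[z](scalerK k0) -xE.
    exact: memvZ.
- by rewrite -memv0 in z0; apply: contraNneq z0 => <-; apply: memv_line.
- by move=> x /vlineP[k ->] y; rewrite linearZl_LR zc scaler0.
Qed.

Definition lincomb n (V : vectType F) (X : seq V) (v : 'rV[F]_n) : V :=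
  \sum_i v 0 i *: X`_i.

Fact lincomb_linear n (V : vectType F) (X : seq V) : linear (@lincomb n V X).
Proof.
move=> k u v; rewrite /lincomb scaler_sumr -big_split; apply: eq_bigr => i _.
by rewrite /= !mxE scalerA scalerDl.
Qed.

HB.instance Definition _ n (V : vectType F) (X : seq V) :=
  GRing.isLinear.Build F 'rV[F]_n V *:%R (lincomb X) (lincomb_linear X).

Lemma lincomb_delta n (V : vectType F) (X : seq V) (i : 'I_n) :
  lincomb X (delta_mx 0 i) = X`_i.
Proof.
rewrite /lincomb (bigD1 i) //= mxE !eqxx scale1r big1 ?addr0 // => j /negPf ji.
by rewrite mxE ji scale0r.
Qed.

Lemma free4 (V : vectType F) (x0 x1 x2 x3 : V) :
  (forall k0 k1 k2 k3 : F,
     k0 *: x0 + k1 *: x1 + k2 *: x2 + k3 *: x3 = 0 ->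
     [/\ k0 = 0, k1 = 0, k2 = 0 & k3 = 0]) ->
  free [:: x0; x1; x2; x3].
Proof.
move=> x_indep; apply/(@freeP _ _ 4 [tuple x0; x1; x2; x3]) => k.
rewrite !big_ord_recl big_ord0 /= addr0 !addrA => /x_indep[k0 k1 k2 k3].
by case=> [[|[|[|[|//]]]] lti];
  [rewrite -k0 | rewrite -k1 | rewrite -k2 | rewrite -k3];
  congr k; apply: val_inj.
Qed.

Lemma span4P (V : vectType F) (x0 x1 x2 x3 v : V) :
  \dim {:V} = 4%N -> free [:: x0; x1; x2; x3] ->
  exists k0 k1 k2 k3 : F, v = k0 *: x0 + k1 *: x1 + k2 *: x2 + k3 *: x3.
Proof.
move=> dimV xfree; have bx : basis_of {:V} [tuple x0; x1; x2; x3].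
  by rewrite basisEfree xfree subvf dimV.
move: (coord_basis bx (memvf v)).
by rewrite !big_ord_recl big_ord0 /= addr0 !addrA => ->; do 4!eexists.
Qed.

(** Rows are sent to the corresponding combinations of the basis; by bilinearity only products of
    basis vectors need to be compared. *)
Lemma isomorphic_table J (t : table F) (x0 x1 x2 x3 : J) :
  \dim {:J} = 4%N -> free [:: x0; x1; x2; x3] ->
  (forall i j : 'I_4, [:: x0; x1; x2; x3]`_i ∘ [:: x0; x1; x2; x3]`_j =
     lincomb [:: x0; x1; x2; x3] (basis_prod t i j)) ->
  isomorphic J (algebra_of_table t).
Proof.
move=> dimJ xfree xM; apply: isomorphic_sym.
pose X := [tuple x0; x1; x2; x3].
have bx : basis_of {:J} X by rewrite basisEfree xfree subvf dimJ.
exists (lincomb X : {linear 'rV[F]_4 -> J}).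
  exists (fun x => \row_i coord X i x) => [v|x].
    by apply/rowP=> i; rewrite mxE /= /lincomb coord_sum_free.
  rewrite /= /lincomb [RHS](coord_basis bx (memvf x)).
  by apply: eq_bigr => i _; rewrite mxE.
move=> v w /=; rewrite [LHS]/= /table_prod [in RHS]/lincomb.
rewrite linear_sum linear_sumlz; apply: eq_bigr => i _.
rewrite linear_sum linear_sumr; apply: eq_bigr => j _.
by rewrite linearZl_LR linearZr_LR /= xM linearZ scalerA.
Qed.

End Isomorphism.

(** * Nilpotency and left-normed products *)

Section Nilpotency.

Variables (F : fieldType) (J : algebra F).
Implicit Types (x y a : J) (s : seq J).

Local Notation prods := (foldl (@prodA F J : J -> J -> J)).

Fact prods_linear s : linear (prods^~ s).
Proof.
by elim: s => //= y s IHs k u v; rewrite linearDl linearZl_LR IHs.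
Qed.

(** Left-normed products with [n] factors after the first span the term of index [n.+1] of the lower
    series. *)
Lemma nilpotentP :
  nilpotent_algebra J <->
  exists n : nat, forall x s, size s = n -> prods x s = 0.
Proof.
split=> [[[//|n] _ Jn0]|[n Jn0]].
  exists n => x s sn; apply/eqP; rewrite -memv0 -Jn0.
  elim/last_ind: s n sn {Jn0} => [|s y IHs] n; first by move=> <-; apply: memvf.
  rewrite size_rcons => <-; rewrite foldl_rcons.
  have /mulvsP := subvv (mulvs (lower_power J (size s).+1) fullv).
  by apply; rewrite ?memvf ?IHs.
exists n.+1 => //; rewrite /lower_power /=.
have: forall x s, x \in (fullv : {vspace J}) -> size s = n -> prods x s = 0.
  by move=> x s _; apply: Jn0.
(* The starting space becomes an arbitrary [U], since the induction passes from [U] to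
   [mulvs U fullv]. *)
elim: n {-2}fullv {Jn0} => [|n IHn] U U0.
  by apply/eqP; rewrite -subv0; apply/subvP=> x xU; rewrite memv0 -(U0 x [::]).
rewrite iterSr; apply: IHn => x s.
pose g : {linear J -> J} := HB.pack (prods^~ s)
  (GRing.isLinear.Build F J J *:%R _ (prods_linear s)).
move=> + sn; suff /subvP sUg: (mulvs U fullv <= lker (linfun g))%VS.
  by move=> /sUg; rewrite memv_ker lfunE /= => /eqP.
apply/mulvsP => u v uU _; rewrite memv_ker lfunE /=.
by have /= -> := U0 u (v :: s) uU (congr1 succn sn).
Qed.

Hypothesis nilJ : nilpotent_algebra J.

(** Multiplying [x] by [y] repeatedly gives [k ^+ n *: x], which vanishes for some [n]. *)
Lemma nilpotent_no_eigenvector x y (k : F) : k != 0 -> x ∘ y = k *: x -> x = 0.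
Proof.
have [n Jn0] := nilpotentP.1 nilJ; move=> k0 xy.
suff: k ^+ n *: x = 0.
  by move/eqP; rewrite scaler_eq0 expf_eq0 (negPf k0) andbF => /eqP.
rewrite -(Jn0 x (nseq n y) (size_nseq _ _)); elim: n {Jn0} x xy => [|n IHn] x xy.
  by rewrite scale1r.
by rewrite /= xy exprS mulrC -scalerA IHn // linearZl_LR /= xy.
Qed.

(** All later terms of the sequence have the form [x ∘ y]. If [x] were in their span, then
    [x = x ∘ y] for some [y], so [x] would vanish, having eigenvalue 1. *)
Lemma free_powers (assocJ : associative (@prodA F J : J -> J -> J)) x a n :
  iter n (fun y => y ∘ a) x != 0 -> free (traject (fun y => y ∘ a) x n.+1).
Proof.
elim: n x => [|n IHn] x; first by rewrite /= seq1_free.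
rewrite iterSr trajectS free_cons => xn0; rewrite IHn // andbT.
apply: contra xn0 => xspan.
suff -> : x = 0.
  by rewrite linear0l; elim: n {IHn xspan} => //= n /eqP->; rewrite linear0l.
have: (<<traject (fun y => y ∘ a) (x ∘ a) n.+1>> <=
       limg (linfun (prodA J x : {linear J -> J})))%VS.
  apply/span_subvP => _ /trajectP[i _ ->]; apply/memv_imgP.
  exists (iter i (fun y => y ∘ a) a); first exact: memvf.
  by rewrite lfunE; elim: i => //= i ->; rewrite assocJ.
move=> /subvP/(_ x xspan) /memv_imgP[y _]; rewrite lfunE /= => xy.
by apply: (@nilpotent_no_eigenvector x y 1); rewrite ?oner_neq0 // scale1r.
Qed.

End Nilpotency.

(** * Polarization in characteristic zero *)

Section Polarization.

Variables (F : numFieldType) (J : algebra F).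
Hypothesis mulC : commutative (@prodA F J : J -> J -> J).
Hypothesis mulA : associative (@prodA F J : J -> J -> J).

Lemma double_eq0 (x : J) : x + x = 0 -> x = 0.
Proof.
move/eqP; rewrite -mulr2n -scaler_nat scaler_eq0 pnatr_eq0 /=.
by move/eqP.
Qed.

Lemma sqrD (x y : J) : (x + y) ∘ (x + y) = x ∘ x + (x ∘ y + x ∘ y) + y ∘ y.
Proof. by rewrite linearDl !linearDr [y ∘ x]mulC !addrA. Qed.

Lemma square_neq0 : (exists x y : J, x ∘ y != 0) -> exists x : J, x ∘ x != 0.
Proof.
move=> [x [y xy0]]; apply: contrapT => /forallNP sqr0.
have sq (z : J) : z ∘ z = 0 by apply/eqP; apply: contrapT => /negP/sqr0.
case/eqP: xy0; apply: double_eq0.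
by have := sqrD x y; rewrite !sq add0r addr0.
Qed.

(** If all cubes vanish, expanding that of [s + t] gives [s ∘ s ∘ t + s ∘ t ∘ t = 0]. Changing the
    sign of [t] separates the two terms, and polarizing [u ∘ u ∘ v] in [u] then kills every triple
    product. *)
Lemma cube_neq0 : (exists x y z : J, x ∘ y ∘ z != 0) ->
  exists x : J, x ∘ x ∘ x != 0.
Proof.
move=> [x [y [z xyz0]]]; apply: contrapT => /forallNP cub0.
have cu (t : J) : t ∘ t ∘ t = 0 by apply/eqP; apply: contrapT => /negP/cub0.
have sq (u v : J) : u ∘ u ∘ v = 0.
  have cuD (s t : J) : (s ∘ s ∘ t + s ∘ t ∘ t) *+ 3 = 0.
    rewrite -[RHS](cu (s + t)) sqrD linearDr !linearDl !cu add0r addr0.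
    have -> : s ∘ t ∘ s = s ∘ s ∘ t by rewrite mulC mulA.
    have -> : t ∘ t ∘ s = s ∘ t ∘ t by rewrite mulC mulA.
    rewrite !mulrS mulr0n !addr0 -!addrA; congr (_ + _).
    by rewrite addrCA; do 2![congr (_ + _)]; rewrite addrCA.
  have cuD1 (s t : J) : s ∘ s ∘ t = - (s ∘ t ∘ t).
    apply/eqP; rewrite -addr_eq0.
    by have /eqP := cuD s t; rewrite -scaler_nat scaler_eq0 pnatr_eq0.
  have := cuD1 u (- v); rewrite !(linearNl, linearNr) opprK => /eqP.
  rewrite eqr_oppLR => /eqP uuv; apply: double_eq0.
  by rewrite {1}uuv cuD1 addNr.
case/eqP: xyz0; apply: double_eq0.
by have := sq (x + y) z; rewrite sqrD !linearDl !sq add0r addr0.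
Qed.

End Polarization.

Ltac check_table :=
  case=> [[|[|[|[|//]]]] ?] [[|[|[|[|//]]]] ?] // _;
  rewrite /basis_prod ?big_cons big_nil ?xpair_eqE -?val_eqE /=
     ?addr0 ?add0r ?linear0 ?linearZ ?linearN /= ?lincomb_delta //=.

(** The positions 0 to 11 stand for [T4_1], [T4_2], [T4_3 1], [T4_3 (-1)], [T4_4], [T4_5 1],
    [T4_5 (-1)], [T4_7], [T4_11], [T4_12], [T4_13 1], [T4_13 (-1)]. *)
Ltac in_list n := exists (@Ordinal 12 n isT).

(** Permuted lists have equal counts for every predicate; these are sums in [nat], which [ring]
    reorders. *)
Ltac permute_free H :=
  refine (etrans (perm_free _) H); apply/permP => ? /=; ring.

(** * Classification over a real closed field *)

Section Classification.

Variables (R : rcfType) (J : algebra R).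
Implicit Types (a b c x y z : J) (k p q r : R).
Hypotheses (mulC : commutative (@prodA R J : J -> J -> J))
  (mulA : associative (@prodA R J : J -> J -> J))
  (nilJ : nilpotent_algebra J) (dimJ : \dim {:J} = 4%N).

Lemma isomorphic_comm_table (t : table R) (x0 x1 x2 x3 : J) :
  free [:: x0; x1; x2; x3] ->
  (forall i j : 'I_4, (i <= j)%N ->
     [:: x0; x1; x2; x3]`_i ∘ [:: x0; x1; x2; x3]`_j =
     lincomb [:: x0; x1; x2; x3] (basis_prod t i j)) ->
  isomorphic J (algebra_of_table t).
Proof.
move=> xfree xM; apply: isomorphic_table (dimJ) xfree _ => i j.
have [/xM-> // | /ltnW/xM] := leqP i j.
rewrite mulC => ->; congr lincomb; rewrite /basis_prod.
by apply: eq_bigl => p; rewrite orbC.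
Qed.

Let classified := exists i : 'I_12, isomorphic J (J_listed R i).

Lemma free_extend (X : seq J) :
  free X -> (size X < 4)%N -> exists x, free (x :: X).
Proof.
move=> freeX ltX4; have /subvPn[x _ xX] : ~~ (fullv <= <<X>>)%VS.
  apply: contraL ltX4 => /dimvS; rewrite dimJ -leqNgt => /leq_trans-> //.
  exact: dim_span.
by exists x; rewrite free_cons xX.
Qed.

Lemma free_shift (X : seq J) x y :
  free (x :: X) -> y \in <<X>>%VS -> free (x - y :: X).
Proof.
rewrite !free_cons => /andP[xX ->] yX; rewrite andbT.
by apply: contra xX => xyX; rewrite -[x](subrK y) memvD.
Qed.

Lemma free_scale (X : seq J) x k : free (x :: X) -> k != 0 -> free (k *: x :: X).
Proof.
rewrite !free_cons => /andP[xX ->] k0; rewrite andbT.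
by apply: contra xX => kxX; rewrite -[x](scalerK k0) memvZ.
Qed.

(** Used to rescale a vector of square [k *: d] to one of square [d] or [- d]; [r] is the inverse
    square root of the absolute value of [k]. *)
Lemma square_root_scale k : k != 0 ->
  exists2 r, r != 0 & r * r * k = 1 \/ r * r * k = -1.
Proof.
move=> k0; exists (Num.sqrt `|k|)^-1.
  by rewrite invr_eq0 sqrtr_eq0 -ltNge normr_gt0.
rewrite -invfM -expr2 sqr_sqrtr ?normr_ge0 //.
have [k_gt0|k_le0] := ltrP 0 k; first by left; rewrite gtr0_norm ?mulVf.
by right; rewrite ler0_norm // invrN mulNr mulVf.
Qed.

(** * Algebras in which all triple products vanish *)

Section CubeZero.

Hypothesis J3 : forall x y z, x ∘ y ∘ z = 0.

Let J3' x y z : x ∘ (y ∘ z) = 0. Proof. by rewrite mulA J3. Qed.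

(** Multiplying a linear relation by [z] kills [x] and [y] and so isolates the coefficients of [a]
    and [b]. *)
Lemma free_mod_square a b z x y :
  (forall p q, p *: (a ∘ z) + q *: (b ∘ z) = 0 -> p = 0 /\ q = 0) ->
  x ∘ z = 0 -> y ∘ z = 0 ->
  (forall p q, p *: x + q *: y = 0 -> p = 0 /\ q = 0) ->
  free [:: a; b; x; y].
Proof.
move=> abz xz yz xy; apply: free4 => p q r s e.
have := congr1 (fun v => v ∘ z) e; rewrite /= !(linearDl, linearZl_LR) linear0l /=.
rewrite xz yz !scaler0 !addr0 => /abz[p0 q0].
by move: e; rewrite p0 q0 !scale0r !add0r => /xy[r0 s0].
Qed.

(** The basis is [b], [a], [b ∘ b], [b ∘ a], with [b] as the first generator. If [k = 0] it has
    table [T4_12]; otherwise rescaling [a] turns [k] into 1 or -1, which gives [T4_13]. *)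
Lemma classify_square_multiple a b k :
  a ∘ a = k *: (b ∘ b) ->
  (forall p q, p *: (b ∘ b) + q *: (a ∘ b) = 0 -> p = 0 /\ q = 0) ->
  classified.
Proof.
move=> aa ind.
have ind' p q : p *: (b ∘ b) + q *: (b ∘ a) = 0 -> p = 0 /\ q = 0.
  by rewrite [b ∘ a]mulC; apply: ind.
have ind2 p q r : r != 0 ->
    p *: (b ∘ b) + q *: (b ∘ (r *: a)) = 0 -> p = 0 /\ q = 0.
  move=> r0; rewrite linearZr_LR scalerA => /ind'[-> /eqP].
  by rewrite mulf_eq0 (negPf r0) orbF => /eqP.
have basis r : r != 0 ->
    free [:: b; r *: a; b ∘ b; b ∘ (r *: a)].
  move=> r0; apply: (@free_mod_square _ _ b); rewrite ?J3 // => p q.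
    by rewrite [(r *: a) ∘ b]mulC => /ind2; apply.
  by move=> /ind2; apply.
have [k0|k0] := eqVneq k 0.
  in_list 9%N; apply: (isomorphic_comm_table (basis (1 : R) (oner_neq0 _))).
  have aa0 : a ∘ a = 0 by rewrite aa k0 scale0r.
  by rewrite !scale1r; check_table; rewrite ?J3 ?J3' // [_ ∘ b]mulC.
have [r r0 rrk] := square_root_scale k0.
have sqra : (r *: a) ∘ (r *: a) = (r * r * k) *: (b ∘ b).
  by rewrite linearZl_LR linearZr_LR aa /= !scalerA ?mulrA.
move: {ind ind' ind2} (basis r r0) sqra; move: (r *: a) => c cfree sqrc.
case: rrk => rrk; [in_list 10%N | in_list 11%N];
  apply: (isomorphic_comm_table cfree); check_table;
  by rewrite ?J3 ?J3' // sqrc rrk.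
Qed.

Lemma classify_two_squares a b :
  (forall p q, p *: (a ∘ a) + q *: (b ∘ b) = 0 -> p = 0 /\ q = 0) ->
  classified.
Proof.
move=> ind.
(* Both [(s * s) *: (a ∘ a)] and [(t * t) *: (b ∘ b)] equal [- (s * t) *: (a ∘ b)]. *)
have ind0 s t : s *: (a ∘ a) + t *: (a ∘ b) = 0 ->
    s *: (a ∘ b) + t *: (b ∘ b) = 0 -> s = 0 /\ t = 0.
  move=> e1 e2; have : (s * s) *: (a ∘ a) + (- (t * t)) *: (b ∘ b) = 0.
    rewrite scaleNr -[(s * s) *: _]scalerA -[(t * t) *: _]scalerA.
    move/eqP: e1; rewrite addr_eq0 => /eqP->.
    move/eqP: e2; rewrite addrC addr_eq0 => /eqP->.
    by rewrite !scalerN !scalerA opprK mulrC addNr.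
  move=> /ind[/eqP + /eqP]; rewrite oppr_eq0 !mulf_eq0 !orbb.
  by move=> /eqP-> /eqP->.
have abfree : free [:: a; b; a ∘ a; b ∘ b].
  apply: free4 => s t p q e.
  have ea := congr1 (fun v => v ∘ a) e; have eb := congr1 (fun v => v ∘ b) e.
  move: ea eb; rewrite /= !(linearDl, linearZl_LR) !linear0l /= !J3 !scaler0 !addr0.
  rewrite [b ∘ a]mulC => ea eb; have [s0 t0] := ind0 s t ea eb.
  by move: e; rewrite s0 t0 !scale0r !add0r => /ind[].
have [s [t [p [q ab]]]] := span4P (a ∘ b) dimJ abfree.
(* The products of [a ∘ b] with [a] and with [b] vanish, so its expansion has no component along [a]
   or [b]. *)
have [s0 t0] : s = 0 /\ t = 0.
  have ea := congr1 (fun v => v ∘ a) ab; have eb := congr1 (fun v => v ∘ b) ab.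
  move: ea eb; rewrite /= !(linearDl, linearZl_LR) /= !J3 !scaler0 !addr0.
  by rewrite [b ∘ a]mulC => /esym ea /esym eb; apply: ind0 ea eb.
move: ab; rewrite s0 t0 !scale0r !add0r {s t s0 t0 abfree ind0} => ab.
wlog pq : a b p q ind ab / p != 0 \/ (p = 0 /\ q = 0).
  move=> W; have [p0|p0] := eqVneq p 0; last by apply: (W a b p q) => //; left.
  have [q0|q0] := eqVneq q 0; first by apply: (W a b p q) => //; right.
  apply: (W b a q p) => //; last by left.
    by move=> s t; rewrite addrC => /ind[].
  by rewrite mulC ab addrC.
case: pq => [p0|[p0 q0]].
  (* Completing the square: with this [h], the square of [a - h *: b] is a multiple of [b ∘ b]. *)
  pose h := (2 * p)^-1.
  have ww : h *: (a ∘ b) + h *: (a ∘ b) = a ∘ a + (q / p) *: (b ∘ b).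
    rewrite -scalerDl ab scalerDr !scalerA -[in RHS](scale1r (a ∘ a)).
    by congr (_ *: _ + _ *: _); rewrite /h; field.
  have sqr : (a - h *: b) ∘ (a - h *: b) = (h * h - q / p) *: (b ∘ b).
    rewrite linearBl !linearBr !(linearZl_LR, linearZr_LR) /= [b ∘ a]mulC.
    by rewrite scalerA opprB addrCA -addrA -opprD ww opprD addNKr scalerBl.
  apply: (classify_square_multiple sqr) => s t.
  rewrite linearBl linearZl_LR /= ab => e.
  have /ind[/eqP] : (t * p) *: (a ∘ a) + (s + t * (q - h)) *: (b ∘ b) = 0.
    by rewrite -e -addrA -scalerBl scalerDr !scalerA addrCA -scalerDl.
  rewrite mulf_eq0 (negPf p0) orbF => /eqP->.
  by rewrite mul0r addr0.
have ab0 : a ∘ b = 0 by rewrite ab p0 q0 !scale0r addr0.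
(* When [a ∘ b = 0], the elements [a + b] and [a - b] have the same square, and their product is
   [a ∘ a - b ∘ b]. *)
have sqr : (a + b) ∘ (a + b) = 1 *: ((a - b) ∘ (a - b)).
  rewrite scale1r linearBl linearDl !linearBr !linearDr [b ∘ a]mulC ab0.
  by rewrite subr0 addr0 sub0r opprK add0r.
apply: (classify_square_multiple sqr) => s t.
rewrite linearBl linearDl !linearBr [b ∘ a]mulC ab0 subr0 !sub0r opprK => e.
have /ind[e1 e2] : (s + t) *: (a ∘ a) + (s - t) *: (b ∘ b) = 0.
  by rewrite -e !scalerDr scalerN addrACA -scalerDl -scalerBl.
by split; lra.
Qed.

(** Gram-Schmidt diagonalises the form with values on the line of [d], starting from [a]. Ranks 1, 2
    and 3 give [T4_2], [T4_3] and [T4_5]. *)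
Lemma classify_square_line a :
  a ∘ a != 0 -> (forall x y, exists k, x ∘ y = k *: (a ∘ a)) -> classified.
Proof.
set d := a ∘ a => d0 line.
have ad0 : a ∘ d = 0 by rewrite J3'.
have orth x : exists k, a ∘ (x - k *: a) = 0.
  have [k ax] := line a x; exists k.
  by rewrite linearBr linearZr_LR /= ax subrr.
have dafree : free [:: d; a].
  rewrite free_cons span_seq1 seq1_free; apply/andP; split; last first.
    by apply: contraNneq d0 => a0; rewrite /d a0 linear0l.
  apply: contra d0 => /vlineP[k dk]; have [k0|k0] := eqVneq k 0.
    by rewrite dk k0 scale0r.
  have /eqP : k *: d = 0 by rewrite /d -linearZl_LR /= -dk J3.
  by rewrite scaler_eq0 (negPf k0).
have amem (X : seq J) k : k *: a \in <<X ++ [:: d; a]>>%VS.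
  by rewrite memvZ // memv_span // mem_cat !inE eqxx !orbT.
have [allorth|] := pselect (forall x y, a ∘ x = 0 -> a ∘ y = 0 -> x ∘ y = 0).
  have [y yfree] := free_extend dafree isT.
  have [k] := orth y; move: (free_shift yfree (amem [::] k)).
  move: (y - _) => {}y {}yfree ay.
  have [z zfree] := free_extend yfree isT.
  have [l] := orth z; move: (free_shift zfree (amem [:: y] l)).
  move: (z - _) => {}z {}zfree az.
  in_list 1%N; apply: (@isomorphic_comm_table _ a d y z).
    by permute_free zfree.
  by check_table; rewrite ?J3 ?J3' //; apply: allorth.
move=> /existsNP[x /existsNP[y /not_implyP[ax /not_implyP[ay /eqP xy]]]].
(* The form is nonzero on the orthogonal complement of [a], so by polarization some square there is
   nonzero. *)
have [{xy}u [au uu]] : exists u, a ∘ u = 0 /\ u ∘ u != 0.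
  apply: contrapT => /forallNP none.
  have sq v : a ∘ v = 0 -> v ∘ v = 0.
    by move=> av; apply/eqP; apply: contrapT => /negP vv; apply: (none v).
  case/eqP: xy; apply: double_eq0.
  have := sqrD mulC x y; rewrite !sq ?linearDr /= ?ax ?ay ?addr0 //.
  by rewrite add0r.
have [k uuk] := line u u.
have k0 : k != 0 by apply: contraNneq uu => k0; rewrite uuk k0 scale0r.
have [r r0 rrk] := square_root_scale k0.
have {x y ax ay} ufree : free [:: u; d; a].
  rewrite free_cons dafree andbT; apply: contra uu.
  rewrite span_cons span_seq1.
  move=> /memv_addP[_ /vlineP[p ->] [_ /vlineP[q ->] e]].
  move: au; rewrite e linearDr !linearZr_LR /= ad0 scaler0 add0r => /eqP.
  rewrite scaler_eq0 (negPf d0) orbF => /eqP->.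
  by rewrite scale0r addr0 linearZl_LR /= J3 scaler0.
have : free [:: r *: u; d; a] by apply: free_scale.
have : a ∘ (r *: u) = 0 by rewrite linearZr_LR /= au scaler0.
have : (r *: u) ∘ (r *: u) = (r * r * k) *: d.
  by rewrite linearZl_LR linearZr_LR uuk /= !scalerA ?mulrA.
move: (r *: u) (r * r * k) rrk => y e epm yy ay yfree {u au uu uuk r r0 k k0 ufree}.
have ee : e * e = 1 by case: epm => ->; rewrite ?mulrNN mulr1.
have [z zfree] := free_extend yfree isT.
have [z' [z'free az' yz']] :
    exists z', [/\ free [:: z'; y; d; a], a ∘ z' = 0 & y ∘ z' = 0].
  have [p pE] := line a z; have [q qE] := line y z.
  (* Since [y ∘ y = e *: d] and [e * e = 1], division by [e] is multiplication by [e]. *)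
  exists (z - (p *: a + (e * q) *: y)); split.
  - apply: free_shift zfree _.
    by rewrite memvD ?memvZ ?memv_span ?inE ?eqxx ?orbT.
  - by rewrite linearBr linearDr !linearZr_LR /= ay scaler0 addr0 pE subrr.
  - rewrite linearBr linearDr !linearZr_LR /= [y ∘ a]mulC ay scaler0 add0r yy qE.
    by rewrite scalerA mulrAC ee mul1r subrr.
have ya : y ∘ a = 0 by rewrite mulC.
have z'a : z' ∘ a = 0 by rewrite mulC.
have z'y : z' ∘ y = 0 by rewrite mulC.
have [m zz] := line z' z'.
have [m0|m0] := eqVneq m 0.
  have zz0 : z' ∘ z' = 0 by rewrite zz m0 scale0r.
  case: epm => eE; rewrite eE in yy; [in_list 2%N | in_list 3%N];
    apply: (@isomorphic_comm_table _ a y d z'); try permute_free z'free;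
    by check_table; rewrite ?J3 ?J3' // yy scale1r.
have [r r0 rrm] := square_root_scale m0.
have : free [:: r *: z'; y; d; a] by apply: free_scale.
have : a ∘ (r *: z') = 0 by rewrite linearZr_LR /= az' scaler0.
have : y ∘ (r *: z') = 0 by rewrite linearZr_LR /= yz' scaler0.
have : (r *: z') ∘ (r *: z') = (r * r * m) *: d.
  by rewrite linearZl_LR linearZr_LR zz /= !scalerA ?mulrA.
move: (r *: z') (r * r * m) rrm => {z z' zz m m0 r r0 z'y z'a yz' az' z'free zfree} z f.
move=> fpm zz yz az zfree.
have za : z ∘ a = 0 by rewrite mulC.
have zy : z ∘ y = 0 by rewrite mulC.
case: epm => eE; rewrite {e ee}eE ?scale1r in yy;
  case: fpm => fE; rewrite {f}fE ?scale1r in zz.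
- in_list 5%N; apply: (@isomorphic_comm_table _ a y z d).
    by permute_free zfree.
  by check_table; rewrite ?J3 ?J3' // scale1r.
- in_list 6%N; apply: (@isomorphic_comm_table _ a y z d).
    by permute_free zfree.
  by check_table; rewrite ?J3 ?J3'.
- in_list 6%N; apply: (@isomorphic_comm_table _ a z y d).
    by permute_free zfree.
  by check_table; rewrite ?J3 ?J3'.
(* Replacing [d] by its negative turns one plus and two minus signs into two plus and one minus; [y]
   and [z] then come first. *)
- in_list 6%N; apply: (@isomorphic_comm_table _ y z a (-1 *: d)).
    rewrite (perm_free (Y := [:: -1 *: d; z; y; a])); last first.
      by apply/permP => ? /=; ring.
    apply: free_scale; last by rewrite oppr_eq0 oner_eq0.
    by permute_free zfree.
  check_table; rewrite ?linearZr_LR ?linearZl_LR /= ?J3 ?J3' ?scaler0 //.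
  by rewrite scalerA mulrNN mulr1 scale1r.
Qed.

End CubeZero.

(** * Algebras with a nonzero cube *)

Lemma classify_cube_neq0 a : a ∘ a ∘ a != 0 -> classified.
Proof.
move=> a3.
have [a4|a4] := eqVneq (a ∘ a ∘ a ∘ a) 0; last first.
  have afree : free [:: a; a ∘ a; a ∘ a ∘ a; a ∘ a ∘ a ∘ a].
    exact: (@free_powers _ _ nilJ mulA a a 3).
  (* A nonzero fifth power would give five independent powers in dimension 4. *)
  have a5 : a ∘ a ∘ a ∘ a ∘ a = 0.
    apply/eqP/negPn/negP => /(@free_powers _ _ nilJ mulA a a 4) /eqP dim5.
    have := dimvS (subvf <<traject (fun y => y ∘ a) a 5>>).
    by rewrite dim5 dimJ.
  in_list 8%N; apply: (isomorphic_comm_table afree); check_table;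
    by rewrite ?mulA ?a5 ?linear0l.
have a3free : free [:: a; a ∘ a; a ∘ a ∘ a].
  exact: (@free_powers _ _ nilJ mulA a a 2).
have powers_ind p q r : p *: a + q *: (a ∘ a) + r *: (a ∘ a ∘ a) = 0 ->
    [/\ p = 0, q = 0 & r = 0].
  move/(@freeP _ _ 3 [tuple a; a ∘ a; a ∘ a ∘ a]): a3free.
  move=> /(_ (fun i => [:: p; q; r]`_i)); rewrite !big_ord_recl big_ord0 /=.
  rewrite addr0 !addrA => H /H {}H.
  by have := (H 0, H 1, H (inord 2)); rewrite /= inordK //= => -[[]].
have a_a3 : a ∘ (a ∘ a ∘ a) = 0 by rewrite mulA mulA a4.
have [y0 y0free] := free_extend a3free isT.
have [p [q [r [s ay0]]]] := span4P (a ∘ y0) dimJ y0free.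
have [y yfree ay] : exists2 y, free [:: y; a; a ∘ a; a ∘ a ∘ a] & a ∘ y = 0.
  have aspan u v w :
      u *: a + v *: (a ∘ a) + w *: (a ∘ a ∘ a) \in <<[:: a; a ∘ a; a ∘ a ∘ a]>>%VS.
    by rewrite !memvD // memvZ // memv_span // !inE eqxx ?orbT.
  have [p0|p0] := eqVneq p 0.
    (* This correction removes the terms in [r] and [s] from [a ∘ y0]. What remains is [q *: a], and
       [q != 0] would make [a] an eigenvector of a nilpotent multiplication. *)
    exists (y0 - (r *: a + s *: (a ∘ a) + 0 *: (a ∘ a ∘ a))).
      exact: free_shift.
    have ayq : a ∘ (y0 - (r *: a + s *: (a ∘ a) + 0 *: (a ∘ a ∘ a))) = q *: a.
      rewrite linearBr !linearDr !linearZr_LR /= ay0 p0 scale0r add0r.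
      by rewrite scale0r addr0 mulA -[q *: a + _ + _]addrA addrK.
    rewrite ayq; have [->|q0] := eqVneq q 0; first by rewrite scale0r.
    by rewrite (nilpotent_no_eigenvector nilJ q0 ayq) scaler0.
  (* Here [y0] can be corrected to an eigenvector of the nilpotent operator
     [a ∘ _] for the eigenvalue [p]. *)
  pose u := - q / p; pose v := (u - r) / p; pose w := (v - s) / p.
  have /free_not0/(_ (mem_head _ _))/eqP[] := free_shift y0free (aspan u v w).
  apply: (@nilpotent_no_eigenvector _ _ nilJ _ a p) => //.
  rewrite mulC linearBr !linearDr !linearZr_LR /= ay0 a_a3 scaler0 addr0 mulA.
  have pu : p * u = - q by rewrite /u; field.
  have pv : p * v = u - r by rewrite /v; field.
  have pw : p * w = v - s by rewrite /w; field.
  rewrite scalerBr !scalerDr !scalerA pu pv pw -!addrA; congr (_ + _).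
  rewrite !opprD -!scaleNr !opprB !opprK !scalerBl !scaleNr !addrA.
  by congr (_ - _); rewrite addrAC.
have [p1 [q1 [r1 [s1 yy]]]] := span4P (y ∘ y) dimJ yfree.
(* Multiplying the expansion of [y ∘ y] by [a] leaves [q1 *: (a ∘ a) + r1 *: (a ∘ a ∘ a) = 0]. *)
have [_ q0 r0] : [/\ 0 = 0 :> R, q1 = 0 & r1 = 0].
  apply: powers_ind; rewrite scale0r add0r.
  have := congr1 (fun v => a ∘ v) yy.
  rewrite /= mulA ay linear0l !linearDr !linearZr_LR /= ay a_a3 !scaler0.
  by rewrite add0r addr0 mulA => <-.
move: yy; rewrite {p q r s ay0 y0free} q0 r0 !scale0r !addr0 => yy.
have a3y : a ∘ a ∘ a ∘ y = 0 by rewrite -!mulA ay !linear0r.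
(* Multiplication by [y] sends [y ∘ y] to [p1 *: (y ∘ y)]. So [p1 != 0] would give [y ∘ y = 0] and
   make [y] a multiple of [a ∘ a ∘ a]. *)
have p0 : p1 = 0.
  apply: contraTeq yfree => p0.
  have /eqP : p1 *: y + s1 *: (a ∘ a ∘ a) = 0.
    rewrite -yy; apply: (@nilpotent_no_eigenvector _ _ nilJ _ y _ p0).
    by rewrite {1}yy linearDl !linearZl_LR /= a3y scaler0 addr0.
  rewrite addr_eq0 -scaleNr => /eqP py.
  rewrite free_cons -[y](scalerK p0) py negb_and negbK.
  by rewrite !memvZ // memv_span // !inE eqxx !orbT.
move: yy; rewrite p0 scale0r add0r => yy.
have [s0|s0] := eqVneq s1 0.
  in_list 4%N; apply: (@isomorphic_comm_table _ a (a ∘ a) (a ∘ a ∘ a) y).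
    by permute_free yfree.
  check_table; rewrite ?mulA ?a4 ?linear0l // -?mulA ?ay ?linear0r //.
  by rewrite yy s0 scale0r.
(* With [a' = s1 *: a] and [y' = s1 *: y], [y' ∘ y' = a' ∘ a' ∘ a'] whatever the
   sign of [s1]. *)
in_list 7%N; apply: (@isomorphic_comm_table _ (s1 *: a)
  ((s1 ^+ 2) *: (a ∘ a)) (s1 *: y) ((s1 ^+ 3) *: (a ∘ a ∘ a))).
  (* Each move from head to tail scales one vector; four moves scale the whole basis. *)
  have rotate (X : seq J) x k : k != 0 -> free (x :: X) -> free (rcons X (k *: x)).
    move=> k0 /free_scale/(_ k0) kfree.
    by rewrite (perm_free (Y := k *: x :: X)) // perm_rcons.
  rewrite (_ : [:: _; _; _; _] = rcons (rcons (rcons (rcons [::]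
    (s1 *: a)) (s1 ^+ 2 *: (a ∘ a))) (s1 *: y)) (s1 ^+ 3 *: (a ∘ a ∘ a))) //.
  by do 4![apply: (rotate [:: _; _; _]); rewrite ?expf_neq0 //=];
    permute_free yfree.
check_table; rewrite !(linearZr_LR, linearZl_LR) /= ?mulA ?a4 ?linear0l;
  rewrite ?scaler0 ?scalerA //.
- by congr (_ *: _); rewrite [RHS]exprSr.
- by rewrite ay scaler0.
- by rewrite -mulA ay linear0r scaler0.
- by rewrite yy scalerA; congr (_ *: _); rewrite !exprS mulr1 mulrA.
- by rewrite [y ∘ a]mulC ay !linear0l scaler0.
Qed.

Lemma nilpotent_classification : classified.
Proof.
have [/(cube_neq0 mulC mulA)[a]|cub0] := pselect (exists x y z, x ∘ y ∘ z != 0).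
  exact: classify_cube_neq0.
have J3 x y z : x ∘ y ∘ z = 0.
  by apply/eqP/negPn/negP => xyz; apply: cub0; exists x, y, z.
have [/(square_neq0 mulC)[a aa]|sqr0] := pselect (exists x y, x ∘ y != 0).
  have [line|/existsNP[b /forallNP bb]] :=
    pselect (forall x, exists k, x ∘ x = k *: (a ∘ a)).
  - apply: (classify_square_line J3 aa) => x y.
    have [k xx] := line x; have [l yy] := line y; have [m xy] := line (x + y).
    (* Twice [x ∘ y] is the square of [x + y] minus the squares of [x] and [y]. *)
    exists (2^-1 * (m - k - l)); move: xy; rewrite sqrD // xx yy => xy.
    have : x ∘ y + x ∘ y = (m - k - l) *: (a ∘ a).
      by rewrite !scalerBl -xy addrAC addrK addrAC subrr add0r.
    rewrite -scalerA => <-; rewrite -mulr2n -scaler_nat scalerA mulVf ?scale1r //.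
    by rewrite pnatr_eq0.
  - apply: (classify_two_squares J3 (a := a) (b := b)) => p q e.
    have q0 : q = 0.
      apply/eqP/negPn/negP => q0; apply: (bb (- (q^-1 * p))).
      apply/eqP; rewrite scaleNr -scalerA -addr_eq0 -{1}[b ∘ b](scalerK q0).
      by rewrite -scalerDr addrC e scaler0.
    split=> //; move/eqP: e.
    by rewrite q0 scale0r addr0 scaler_eq0 (negPf aa) orbF => /eqP.
have [x /free_extend[//|y /free_extend[//|z /free_extend[//|t tfree]]]] :=
  free_extend (nil_free J) isT.
in_list 0%N; apply: (isomorphic_comm_table tfree); check_table;
  by apply/eqP/negPn/negP => xy; apply: sqr0; do 2!eexists; exact: xy.
Qed.

End Classification.

(** * Isomorphism invariants *)

Section Invariants.

Variable F : fieldType.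
Implicit Types J K : algebra F.

Definition nonzero_product J : Prop := exists x y : J, x ∘ y != 0.

Definition nonzero_cube J : Prop := exists x y z : J, x ∘ y ∘ z != 0.

Definition nonzero_fourth J : Prop := exists x y z t : J, x ∘ y ∘ z ∘ t != 0.

(** When all products lie on a line, such an [x] is an isotropic vector outside the radical of the
    form. *)
Definition null_square J : Prop := exists2 x : J, x ∘ x = 0 & ~ in_centre x.

Definition null_product J : Prop :=
  exists x y : J, [/\ x ∘ y = 0, ~ in_centre x & ~ in_centre y].

(** This fails whenever all products lie on a line, which separates [T4_5] from [T4_12] and
    [T4_13]. *)
Definition independent_products J : Prop :=
  exists x y : J, forall p q : F,
    p *: (x ∘ x) + q *: (x ∘ y) = 0 -> p = 0 /\ q = 0.

(** A decision tree of invariant properties, arranged so that its value on each listed algebra is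
    the position of that algebra in the list. *)
Definition signature J : nat :=
  if `[< centre_outside_square J >] then
    if `[< nonzero_cube J >] then 4
    else if `[< null_square J >] then 3
    else if `[< null_product J >] then 2
    else if `[< nonzero_product J >] then 1 else 0
  else
    if `[< nonzero_fourth J >] then 8
    else if `[< nonzero_cube J >] then 7
    else if `[< null_square J >] then
      if `[< independent_products J >] then 9 else 6
    else if `[< null_product J >] then
      if `[< independent_products J >] then 10 else 5
    else 11.

Lemma signature_isomorphic J K : isomorphic J K -> signature J = signature K.
Proof.
move=> JK; have KJ := isomorphic_sym JK.
have iff_sym (P : algebra F -> Prop) :
    (forall A B, isomorphic A B -> P A -> P B) ->
    `[< P J >] = `[< P K >].
  by move=> PAB; apply: asbool_equiv_eq; split; apply: PAB.
rewrite /signature.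
have centre (A B : algebra F) (f : {linear A -> B}) x : bijective f ->
    {morph f : x y / x ∘ y >-> x ∘ y} -> in_centre (f x) -> in_centre x.
  by move=> [g fK _] fM fxc y; apply: (can_inj fK); rewrite fM fxc linear0.
rewrite (iff_sym (@centre_outside_square F)) //; last first.
  (* The isomorphism is reversed so that [W] can be carried over as a preimage. *)
  move=> A B /isomorphic_sym[f [g fK gK] fM] [z [W [zc AW zW]]].
  exists (g z), (linfun f @^-1: W)%VS; split.
  - by move=> y; apply: (can_inj fK); rewrite fM gK zc linear0.
  - by move=> x y; rewrite -memv_preim lfunE /= fM.
  - by rewrite -memv_preim lfunE /= gK.
rewrite (iff_sym nonzero_cube) //; last first.
  move=> A B [f [g fK gK] fM] [x [y [z xyz]]]; exists (f x), (f y), (f z).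
  by rewrite -!fM -(linear0 f) (inj_eq (can_inj fK)).
rewrite (iff_sym nonzero_fourth) //; last first.
  move=> A B [f [g fK gK] fM] [x [y [z [t xyzt]]]]; exists (f x), (f y), (f z), (f t).
  by rewrite -!fM -(linear0 f) (inj_eq (can_inj fK)).
rewrite (iff_sym null_square) //; last first.
  move=> A B [f fbij fM] [x xx xc]; exists (f x); first by rewrite -fM xx linear0.
  by move/(centre _ _ f x fbij fM).
rewrite (iff_sym null_product) //; last first.
  move=> A B [f fbij fM] [x [y [xy xc yc]]]; exists (f x), (f y).
  by split; [rewrite -fM xy linear0 | move/(centre _ _ f x fbij fM) |
    move/(centre _ _ f y fbij fM)].
rewrite (iff_sym nonzero_product) //; last first.
  move=> A B [f [g fK gK] fM] [x [y xy]]; exists (f x), (f y).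
  by rewrite -!fM -(linear0 f) (inj_eq (can_inj fK)).
rewrite (iff_sym independent_products) //.
move=> A B [f [g fK gK] fM] [x [y xy]]; exists (f x), (f y) => p q.
by move=> e; apply: xy; apply: (can_inj fK); rewrite linearD !linearZ /= !fM e linear0.
Qed.

End Invariants.

(** * Table products in coordinates *)

Section TableProducts.

Variable F : fieldType.
Implicit Type t : table F.

Lemma table_prod_comm t : commutative (table_prod t).
Proof.
move=> x y; rewrite /table_prod exchange_big; apply: eq_bigr => i _.
apply: eq_bigr => j _; rewrite mulrC; congr (_ *: _).
by apply: eq_bigl => p; rewrite orbC.
Qed.

(** After exchanging the sums, an entry at [(i, j)] contributes only at [(i, j)] and [(j, i)], which
    coincide on the diagonal. *)
Lemma table_prodE t (x y : 'rV[F]_4) : table_prod t x y =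
  \sum_(p <- t) (if p.1.1 == p.1.2 then x 0 p.1.1 * y 0 p.1.1
                 else x 0 p.1.1 * y 0 p.1.2 + x 0 p.1.2 * y 0 p.1.1) *: p.2.
Proof.
rewrite /table_prod pair_big /=.
under eq_bigr => q _ do rewrite /basis_prod big_mkcond scaler_sumr.
rewrite exchange_big; apply: eq_bigr => -[[i j] v] _ /=.
rewrite (bigD1 (i, j)) //= eqxx /= big_mkcond /=.
have [->|ij] := eqVneq i j.
  rewrite big1 ?addr0 // => -[k l] _ /=; case: ifP => // /negPf klj.
  by rewrite !(eq_sym (j, j)) klj xpair_eqE andbC -xpair_eqE klj scaler0.
rewrite (bigD1 (j, i)) //= eqxx orbT xpair_eqE negb_and eq_sym ij /= big1.
  by rewrite addr0 scalerDl.
move=> [k l] /negPf klji; case: ifP => // /negPf klij.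
rewrite !(eq_sym (i, j)) klij xpair_eqE andbC -xpair_eqE klji.
by rewrite scaler0.
Qed.

Definition row4 (a b c d : F) : 'rV[F]_4 := \row_(i < 4) [:: a; b; c; d]`_i.

Lemma row4P (u v : 'rV[F]_4) :
  u 0 (@Ordinal 4 0 isT) = v 0 (@Ordinal 4 0 isT) ->
  u 0 (@Ordinal 4 1 isT) = v 0 (@Ordinal 4 1 isT) ->
  u 0 (@Ordinal 4 2 isT) = v 0 (@Ordinal 4 2 isT) ->
  u 0 (@Ordinal 4 3 isT) = v 0 (@Ordinal 4 3 isT) -> u = v.
Proof.
move=> e0 e1 e2 e3; apply/rowP=> -[[|[|[|[|//]]]] lti].
- by move: e0; congr (u 0 _ = v 0 _); apply: val_inj.
- by move: e1; congr (u 0 _ = v 0 _); apply: val_inj.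
- by move: e2; congr (u 0 _ = v 0 _); apply: val_inj.
- by move: e3; congr (u 0 _ = v 0 _); apply: val_inj.
Qed.

Local Notation a := (@Ordinal 4 0 isT).
Local Notation b := (@Ordinal 4 1 isT).
Local Notation c := (@Ordinal 4 2 isT).
Local Notation d := (@Ordinal 4 3 isT).

Ltac table_prod_row :=
  rewrite table_prodE ?big_cons big_nil -?val_eqE /=;
  apply: row4P; rewrite !mxE -?val_eqE /=; ring.

Lemma T4_1_prod (x y : 'rV[F]_4) : table_prod (T4_1 F) x y = row4 0 0 0 0.
Proof. table_prod_row. Qed.

Lemma T4_2_prod (x y : 'rV[F]_4) :
  table_prod (T4_2 F) x y = row4 0 (x 0 a * y 0 a) 0 0.
Proof. table_prod_row. Qed.

Lemma T4_3_prod alpha (x y : 'rV[F]_4) : table_prod (T4_3 alpha) x y =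
  row4 0 0 (x 0 a * y 0 a + alpha * (x 0 b * y 0 b)) 0.
Proof. table_prod_row. Qed.

Lemma T4_4_prod (x y : 'rV[F]_4) : table_prod (T4_4 F) x y =
  row4 0 (x 0 a * y 0 a) (x 0 a * y 0 b + x 0 b * y 0 a) 0.
Proof. table_prod_row. Qed.

Lemma T4_5_prod alpha (x y : 'rV[F]_4) : table_prod (T4_5 alpha) x y =
  row4 0 0 0 (x 0 a * y 0 a + x 0 b * y 0 b + alpha * (x 0 c * y 0 c)).
Proof. table_prod_row. Qed.

Lemma T4_7_prod (x y : 'rV[F]_4) : table_prod (T4_7 F) x y =
  row4 0 (x 0 a * y 0 a) 0 (x 0 a * y 0 b + x 0 b * y 0 a + x 0 c * y 0 c).
Proof. table_prod_row. Qed.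

Lemma T4_11_prod (x y : 'rV[F]_4) : table_prod (T4_11 F) x y =
  row4 0 (x 0 a * y 0 a) (x 0 a * y 0 b + x 0 b * y 0 a)
    (x 0 a * y 0 c + x 0 c * y 0 a + x 0 b * y 0 b).
Proof. table_prod_row. Qed.

Lemma T4_12_prod (x y : 'rV[F]_4) : table_prod (T4_12 F) x y =
  row4 0 0 (x 0 a * y 0 a) (x 0 a * y 0 b + x 0 b * y 0 a).
Proof. table_prod_row. Qed.

Lemma T4_13_prod alpha (x y : 'rV[F]_4) : table_prod (T4_13 alpha) x y =
  row4 0 0 (x 0 a * y 0 a + alpha * (x 0 b * y 0 b))
    (x 0 a * y 0 b + x 0 b * y 0 a).
Proof. table_prod_row. Qed.

End TableProducts.

Ltac row_eq := apply: row4P; rewrite !mxE -?val_eqE /=; ring.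

Ltac row_coords H :=
  move/rowP: H => H;
  move: (H (@Ordinal 4 0 isT)) (H (@Ordinal 4 1 isT))
        (H (@Ordinal 4 2 isT)) (H (@Ordinal 4 3 isT)) => {H};
  rewrite !mxE /= ?(mulr1, mulr0, mul1r, mul0r, addr0, add0r).

(** * The twelve listed algebras *)

Section ListedAlgebras.

Variable R : realType.

Local Notation a := (@Ordinal 4 0 isT).
Local Notation b := (@Ordinal 4 1 isT).
Local Notation c := (@Ordinal 4 2 isT).
Local Notation d := (@Ordinal 4 3 isT).
Local Notation e i := (delta_mx 0 i : 'rV[R]_4).
Local Notation alg := algebra_of_table.

Lemma J_listed_ind (P : nat -> algebra R -> Prop) :
  P 0%N (alg (T4_1 R)) -> P 1%N (alg (T4_2 R)) ->
  P 2%N (alg (T4_3 (1 : R))) -> P 3%N (alg (T4_3 (-1 : R))) ->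
  P 4%N (alg (T4_4 R)) ->
  P 5%N (alg (T4_5 (1 : R))) -> P 6%N (alg (T4_5 (-1 : R))) ->
  P 7%N (alg (T4_7 R)) -> P 8%N (alg (T4_11 R)) -> P 9%N (alg (T4_12 R)) ->
  P 10%N (alg (T4_13 (1 : R))) -> P 11%N (alg (T4_13 (-1 : R))) ->
  forall i : 'I_12, P i (J_listed R i).
Proof.
move=> P0 P1 P2 P3 P4 P5 P6 P7 P8 P9 P10 P11.
by case=> -[|[|[|[|[|[|[|[|[|[|[|[|]]]]]]]]]]]].
Qed.

(** Five factors suffice for the whole list: the longest nonzero product is the fourth power in
    [T4_11]. *)
Lemma table_comm_nilp_assoc (t : table R) :
  associative (table_prod t) ->
  (forall x y z u v, table_prod t
     (table_prod t (table_prod t (table_prod t x y) z) u) v = 0) ->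
  is_comm_nilp_assoc (alg t).
Proof.
move=> tA t5; split=> //; first exact: table_prod_comm.
by apply/nilpotentP; exists 4 => x [|y [|z [|u [|v []]]]] //= _; apply: t5.
Qed.

Lemma J_listed_comm_nilp_assoc (i : 'I_12) : is_comm_nilp_assoc (J_listed R i).
Proof.
move: i; apply: (@J_listed_ind (fun=> @is_comm_nilp_assoc R));
  apply: table_comm_nilp_assoc => [x y z|x y z u v];
  rewrite ?(T4_1_prod, T4_2_prod, T4_3_prod, T4_4_prod, T4_5_prod, T4_7_prod,
    T4_11_prod, T4_12_prod, T4_13_prod); row_eq.
Qed.

Lemma dim_table (t : table R) : \dim {:alg t} = 4%N.
Proof. by rewrite dimvf /dim /= mul1n. Qed.

(** In every table with a central component the last basis vector spans one; [W] is the hyperplane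
    where the last coordinate vanishes. *)
Lemma table_centre_outside_square (t : table R) :
  (forall x y, table_prod t x y 0 d = 0) ->
  (forall y, table_prod t (e d) y = 0) ->
  centre_outside_square (alg t).
Proof.
move=> td dt.
exists (e d : alg t),
  (lker (linfun (mulmxr (delta_mx d d) : 'rV[R]_4 -> 'rV[R]_4))).
split=> //.
- move=> x y; rewrite memv_ker lfunE /=; apply/eqP/rowP => j.
  rewrite !mxE big1 // => k _; rewrite !mxE.
  have [->|] := eqVneq k d; last by rewrite mulr0.
  by rewrite td mul0r.
- rewrite memv_ker lfunE /=; apply/eqP => /rowP/(_ d).
  rewrite !mxE (bigD1 d) //= !mxE !eqxx big1 ?addr0 ?mulr1.
    by move/eqP; rewrite oner_eq0.
  by move=> k /negPf kd; rewrite !mxE kd mulr0.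
Qed.

Ltac outside := apply: table_centre_outside_square => *;
  rewrite ?(T4_1_prod, T4_2_prod, T4_3_prod, T4_4_prod);
  [by rewrite mxE | row_eq].

Ltac vanishing :=
  by rewrite /= ?(T4_1_prod, T4_2_prod, T4_3_prod, T4_4_prod, T4_5_prod, T4_7_prod,
    T4_11_prod, T4_12_prod, T4_13_prod); row_eq.

Local Notation ea := (row4 1 0 0 0 : 'rV[R]_4).
Local Notation eb := (row4 0 1 0 0 : 'rV[R]_4).
Local Notation ec := (row4 0 0 1 0 : 'rV[R]_4).

(** * Signatures of the algebras with a central component *)

Lemma T4_1_signature : signature (alg (T4_1 R)) = 0%N.
Proof.
rewrite /signature asboolT; last by outside.
have sq0 (x y : alg (T4_1 R)) : x ∘ y = 0 by vanishing.
rewrite !asboolF //.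
- by move=> [x [y]]; rewrite sq0 eqxx.
- by move=> [x [y [_ xc _]]]; apply: xc => z; apply: sq0.
- by move=> [x _ xc]; apply: xc => z; apply: sq0.
- by move=> [x [y [z]]]; rewrite sq0 eqxx.
Qed.

Lemma T4_2_signature : signature (alg (T4_2 R)) = 1%N.
Proof.
have centre (x : alg (T4_2 R)) : x 0 a = 0 -> in_centre x.
  by move=> xa y; rewrite /= T4_2_prod xa; row_eq.
rewrite /signature asboolT; last by outside.
rewrite asboolF; last by move=> [x [y [z /eqP]]]; apply; vanishing.
rewrite asboolF; last first.
  move=> [x] /=; rewrite T4_2_prod => xx; case; apply: centre.
  by row_coords xx => _ /eqP; rewrite mulf_eq0 orbb => /eqP.
rewrite asboolF; last first.
  move=> [x [y []]] /=; rewrite T4_2_prod => xy xc yc.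
  row_coords xy => _ /eqP; rewrite mulf_eq0 => /orP[] /eqP xy0 _ _.
    exact/xc/centre.
  exact/yc/centre.
rewrite asboolT //; exists ea, ea; rewrite /= T4_2_prod; apply/eqP => aa.
by row_coords aa => _ /eqP; rewrite oner_eq0.
Qed.

Lemma T4_3_signature : signature (alg (T4_3 (1 : R))) = 2%N.
Proof.
have centre (x : alg (T4_3 (1 : R))) : x 0 a = 0 -> x 0 b = 0 -> in_centre x.
  by move=> xa xb y; rewrite /= T4_3_prod xa xb; row_eq.
rewrite /signature asboolT; last by outside.
rewrite asboolF; last by move=> [x [y [z /eqP]]]; apply; vanishing.
rewrite asboolF; last first.
  move=> [x] /=; rewrite T4_3_prod => xx; case; apply: centre;
  by row_coords xx => _ _ ? _; nra.
rewrite asboolT //; exists ea, eb; split.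
- by vanishing.
- move/(_ ea); rewrite /= T4_3_prod => aa.
  by row_coords aa => _ _ /eqP; rewrite oner_eq0.
- move/(_ eb); rewrite /= T4_3_prod => bb.
  by row_coords bb => _ _ /eqP; rewrite oner_eq0.
Qed.

Lemma T4_3N_signature : signature (alg (T4_3 (-1 : R))) = 3%N.
Proof.
rewrite /signature asboolT; last by outside.
rewrite asboolF; last by move=> [x [y [z /eqP]]]; apply; vanishing.
(* An isotropic vector: the squares of the first two basis vectors cancel. *)
rewrite asboolT //; exists (row4 1 1 0 0 : 'rV[R]_4); first by vanishing.
move/(_ ea); rewrite /= T4_3_prod => xa.
by row_coords xa => _ _ /eqP; rewrite oner_eq0.
Qed.

Lemma T4_4_signature : signature (alg (T4_4 R)) = 4%N.
Proof.
rewrite /signature asboolT; last by outside.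
rewrite asboolT //; exists ea, ea, ea; rewrite /= !T4_4_prod; apply/eqP => aaa.
by row_coords aaa => _ _ /eqP; rewrite oner_eq0.
Qed.

(** A subspace containing all products contains their sums. Two summands suffice because the centre
    of each table concerned has dimension at most 2. *)
Lemma not_centre_outside_square (J : algebra R) :
  (forall z : J, in_centre z -> exists x y u v : J, z = x ∘ y + u ∘ v) ->
  ~ centre_outside_square J.
Proof.
move=> centreJ [z [W [/centreJ[x [y [u [v ->]]]] JW]]].
by rewrite memvD ?JW.
Qed.

Lemma T4_5_centre (alpha : R) (z : alg (T4_5 alpha)) : alpha != 0 ->
  in_centre z -> [/\ z 0 a = 0, z 0 b = 0 & z 0 c = 0].
Proof.
move=> alpha0 zc; have za := zc ea; have zb := zc eb; have zz := zc ec.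
move: za zb zz; rewrite /= !T4_5_prod => za zb zz.
row_coords za => _ _ _ ->; row_coords zb => _ _ _ ->.
row_coords zz => _ _ _ /eqP; rewrite mulf_eq0 (negPf alpha0) => /eqP->.
by [].
Qed.

Lemma T4_5_not_outside (alpha : R) :
  alpha != 0 -> ~ centre_outside_square (alg (T4_5 alpha)).
Proof.
move=> alpha0; apply: not_centre_outside_square => z /(T4_5_centre alpha0)[za zb zc].
exists (row4 (z 0 d) 0 0 0 : 'rV[R]_4), ea, 0, 0; rewrite linear0l addr0 /= T4_5_prod.
by apply: row4P; rewrite ?za ?zb ?zc !mxE /=; ring.
Qed.

Lemma T4_7_not_outside : ~ centre_outside_square (alg (T4_7 R)).
Proof.
apply: not_centre_outside_square => z zz; have za := zz ea; have zc := zz ec.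
move: za zc; rewrite /= !T4_7_prod => za zc.
row_coords za => _ za _ zb; row_coords zc => _ _ _ zc.
exists (row4 (z 0 d) 0 0 0 : 'rV[R]_4), eb, 0, 0; rewrite linear0l addr0 /= T4_7_prod.
by apply: row4P; rewrite ?za ?zb ?zc !mxE /=; ring.
Qed.

Lemma T4_11_not_outside : ~ centre_outside_square (alg (T4_11 R)).
Proof.
apply: not_centre_outside_square => z zz; have := zz ea.
rewrite /= T4_11_prod => za; row_coords za => _ za zb zc.
exists (row4 (z 0 d) 0 0 0 : 'rV[R]_4), ec, 0, 0; rewrite linear0l addr0 /= T4_11_prod.
by apply: row4P; rewrite ?za ?zb ?zc !mxE /=; ring.
Qed.

Lemma T4_12_not_outside : ~ centre_outside_square (alg (T4_12 R)).
Proof.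
apply: not_centre_outside_square => z zz; have := zz ea.
rewrite /= T4_12_prod => za; row_coords za => _ _ za zb.
exists (row4 (z 0 c) 0 0 0 : 'rV[R]_4), ea, (row4 (z 0 d) 0 0 0 : 'rV[R]_4), eb.
rewrite /= !T4_12_prod.
by apply: row4P; rewrite ?za ?zb !mxE /=; ring.
Qed.

Lemma T4_13_not_outside (alpha : R) : ~ centre_outside_square (alg (T4_13 alpha)).
Proof.
apply: not_centre_outside_square => z zz; have := zz ea.
rewrite /= T4_13_prod => za; row_coords za => _ _ za zb.
exists (row4 (z 0 c) 0 0 0 : 'rV[R]_4), ea, (row4 (z 0 d) 0 0 0 : 'rV[R]_4), eb.
rewrite /= !T4_13_prod.
by apply: row4P; rewrite ?za ?zb !mxE /=; ring.
Qed.

Lemma T4_5_dependent (alpha : R) : ~ independent_products (alg (T4_5 alpha)).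
Proof.
move=> [x [y indep]].
(* This is the relation between any two vectors on a line. It forces the square of [x] to vanish,
   and then the coefficients 1 and 0 give a nontrivial relation. *)
have [|_ /eqP] := indep ((x ∘ y : 'rV[R]_4) 0 d) (- (x ∘ x : 'rV[R]_4) 0 d).
  by rewrite /= !T4_5_prod; row_eq.
rewrite oppr_eq0 => /eqP xx.
have [|/eqP] := indep 1 0; last by rewrite oner_eq0.
by move: xx; rewrite /= !T4_5_prod !mxE /= => ->; row_eq.
Qed.

(** * Signatures of the algebras without a central component *)

Lemma T4_5_signature : signature (alg (T4_5 (1 : R))) = 5%N.
Proof.
rewrite /signature asboolF; last exact/T4_5_not_outside/oner_neq0.
rewrite asboolF; last by move=> [x [y [z [t /eqP]]]]; apply; vanishing.
rewrite asboolF; last by move=> [x [y [z /eqP]]]; apply; vanishing.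
rewrite asboolF; last first.
  move=> [x] /=; rewrite T4_5_prod => xx; case=> y; rewrite /= T4_5_prod.
  row_coords xx => _ _ _ xx.
  have xa : x 0 a = 0 by nra.
  have xb : x 0 b = 0 by nra.
  have xc : x 0 c = 0 by nra.
  by rewrite xa xb xc; row_eq.
rewrite asboolT; last first.
  exists ea, eb; split; first by vanishing.
    move/(_ ea); rewrite /= T4_5_prod => aa.
    by row_coords aa => _ _ _ /eqP; rewrite oner_eq0.
  move/(_ eb); rewrite /= T4_5_prod => bb.
  by row_coords bb => _ _ _ /eqP; rewrite oner_eq0.
by rewrite asboolF //; apply: T4_5_dependent.
Qed.

Lemma T4_5N_signature : signature (alg (T4_5 (-1 : R))) = 6%N.
Proof.
rewrite /signature asboolF; last first.
  by apply: T4_5_not_outside; rewrite oppr_eq0 oner_eq0.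
rewrite asboolF; last by move=> [x [y [z [t /eqP]]]]; apply; vanishing.
rewrite asboolF; last by move=> [x [y [z /eqP]]]; apply; vanishing.
rewrite asboolT; last first.
  exists (row4 1 0 1 0 : 'rV[R]_4); first by vanishing.
  move/(_ ea); rewrite /= T4_5_prod => xa.
  by row_coords xa => _ _ _ /eqP; rewrite oner_eq0.
by rewrite asboolF //; apply: T4_5_dependent.
Qed.

Lemma T4_7_signature : signature (alg (T4_7 R)) = 7%N.
Proof.
rewrite /signature asboolF; last exact: T4_7_not_outside.
rewrite asboolF; last by move=> [x [y [z [t /eqP]]]]; apply; vanishing.
rewrite asboolT //; exists ea, ea, ea; rewrite /= !T4_7_prod; apply/eqP => aaa.
by row_coords aaa => _ _ _ /eqP; rewrite oner_eq0.
Qed.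

Lemma T4_11_signature : signature (alg (T4_11 R)) = 8%N.
Proof.
rewrite /signature asboolF; last exact: T4_11_not_outside.
rewrite asboolT //; exists ea, ea, ea, ea; rewrite /= !T4_11_prod; apply/eqP => aa.
by row_coords aa => _ _ _ /eqP; rewrite oner_eq0.
Qed.

(** Modulo the centre the product is multiplication of dual numbers, with [eb] as the element of
    square zero. *)
Lemma T4_12_signature : signature (alg (T4_12 R)) = 9%N.
Proof.
rewrite /signature asboolF; last exact: T4_12_not_outside.
rewrite asboolF; last by move=> [x [y [z [t /eqP]]]]; apply; vanishing.
rewrite asboolF; last by move=> [x [y [z /eqP]]]; apply; vanishing.
rewrite asboolT; last first.
  exists eb; first by vanishing.
  move/(_ ea); rewrite /= T4_12_prod => ba.
  by row_coords ba => _ _ _ /eqP; rewrite oner_eq0.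
rewrite asboolT //; exists ea, eb => p q; rewrite /= !T4_12_prod => pq.
by row_coords pq.
Qed.

(** Modulo the centre the product is split-complex multiplication, with [j] of square 1: no nonzero
    element has square zero, but [1 + j] and [1 - j] are zero divisors. *)
Lemma T4_13_signature : signature (alg (T4_13 (1 : R))) = 10%N.
Proof.
rewrite /signature asboolF; last exact: T4_13_not_outside.
rewrite asboolF; last by move=> [x [y [z [t /eqP]]]]; apply; vanishing.
rewrite asboolF; last by move=> [x [y [z /eqP]]]; apply; vanishing.
rewrite asboolF; last first.
  move=> [x] /=; rewrite T4_13_prod => xx; case=> y; rewrite /= T4_13_prod.
  row_coords xx => _ _ xx _.
  have xa : x 0 a = 0 by nra.
  have xb : x 0 b = 0 by nra.
  by rewrite xa xb; row_eq.
rewrite asboolT; last first.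
  exists (row4 1 1 0 0 : 'rV[R]_4), (row4 1 (-1) 0 0 : 'rV[R]_4).
  split; first by vanishing.
    move/(_ ea); rewrite /= T4_13_prod => aa.
    by row_coords aa => _ _ /eqP; rewrite oner_eq0.
  move/(_ ea); rewrite /= T4_13_prod => aa.
  by row_coords aa => _ _ /eqP; rewrite oner_eq0.
rewrite asboolT //; exists ea, eb => p q; rewrite /= !T4_13_prod => pq.
by row_coords pq.
Qed.

Lemma T4_13N_signature : signature (alg (T4_13 (-1 : R))) = 11%N.
Proof.
have no_zero_divisor (x y : alg (T4_13 (-1 : R))) :
    x ∘ y = 0 -> in_centre x \/ in_centre y.
  rewrite /= T4_13_prod => xy; row_coords xy => _ _ re im.
  (* Modulo the centre the product is complex multiplication: norms multiply. *)
  have : (x 0 a ^+ 2 + x 0 b ^+ 2) * (y 0 a ^+ 2 + y 0 b ^+ 2) = 0.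
    rewrite (_ : _ * _ = (x 0 a * y 0 a + -1 * (x 0 b * y 0 b)) ^+ 2
      + (x 0 a * y 0 b + x 0 b * y 0 a) ^+ 2); last by ring.
    by rewrite re im; ring.
  move/eqP; rewrite mulf_eq0 => /orP[]; rewrite paddr_eq0 ?sqr_ge0 // !sqrf_eq0;
    move=> /andP[/eqP ua /eqP ub]; [left|right] => z;
    by rewrite /= T4_13_prod ua ub; row_eq.
rewrite /signature asboolF; last exact: T4_13_not_outside.
rewrite asboolF; last by move=> [x [y [z [t /eqP]]]]; apply; vanishing.
rewrite asboolF; last by move=> [x [y [z /eqP]]]; apply; vanishing.
rewrite asboolF; last by move=> [x /no_zero_divisor[]].
by rewrite asboolF // => -[x [y [/no_zero_divisor[]]]].
Qed.

Lemma J_listed_signature (i : 'I_12) : signature (J_listed R i) = i.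
Proof.
move: i; apply: (@J_listed_ind (fun n J => signature J = n)).
- exact: T4_1_signature.
- exact: T4_2_signature.
- exact: T4_3_signature.
- exact: T4_3N_signature.
- exact: T4_4_signature.
- exact: T4_5_signature.
- exact: T4_5N_signature.
- exact: T4_7_signature.
- exact: T4_11_signature.
- exact: T4_12_signature.
- exact: T4_13_signature.
- exact: T4_13N_signature.
Qed.

Lemma J_with_central_component (i : 'I_5) :
  has_central_component (J_with_central R i).
Proof.
have outside_component (t : table R) :
    centre_outside_square (alg t) -> has_central_component (alg t).
  exact/central_component_of_outside_square/table_prod_comm.
case: i => [[|[|[|[|[|//]]]]] lti].
- by apply: (outside_component (T4_1 R)); outside.
- by apply: (outside_component (T4_2 R)); outside.
- by apply: (outside_component (T4_3 1)); outside.
- by apply: (outside_component (T4_3 (-1))); outside.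
- by apply: (outside_component (T4_4 R)); outside.
Qed.

Lemma J_without_central_component (i : 'I_7) :
  ~ has_central_component (J_without_central R i).
Proof.
move/central_component_outside_square; case: i => [[|[|[|[|[|[|[|//]]]]]]] lti].
- exact/T4_5_not_outside/oner_neq0.
- by apply: T4_5_not_outside; rewrite oppr_eq0 oner_eq0.
- exact: T4_7_not_outside.
- exact: T4_11_not_outside.
- exact: T4_12_not_outside.
- exact: T4_13_not_outside.
- exact: T4_13_not_outside.
Qed.

End ListedAlgebras.

Theorem theorem40 (R : realType) :
  [/\ (* each listed algebra is a 4-dimensional commutative nilpotent
         associative algebra *)
      forall i : 'I_12,
        is_comm_nilp_assoc (J_listed R i)
        /\ \dim (fullv : {vspace J_listed R i}) = 4%N,
      (* they are pairwise non-isomorphic *)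
      forall i j : 'I_12,
        isomorphic (J_listed R i) (J_listed R j) -> i = j,
      (* every such algebra is isomorphic to one of them *)
      forall J : algebra R,
        is_comm_nilp_assoc J -> \dim (fullv : {vspace J}) = 4%N ->
        exists i : 'I_12, isomorphic J (J_listed R i),
      forall i : 'I_5, has_central_component (J_with_central R i)
    & forall i : 'I_7, ~ has_central_component (J_without_central R i)].
Proof.
split.
- by move=> i; split; [apply: J_listed_comm_nilp_assoc | apply: dim_table].
- move=> i j /signature_isomorphic; rewrite !J_listed_signature.
  exact: val_inj.
- by move=> J [mulC mulA nilJ] dimJ; apply: nilpotent_classification.
- exact: J_with_central_component.
- exact: J_without_central_component.
Qed.
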